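(* Let $\mathbb F$ be a field, $q,q'\in\mathbb F$ and $f,g,f',g'\in\mathbb F[h]$. Assume $q\neq 0$ and $\deg f>1$. Then $\mathcal H_q(f,g)\cong\mathcal H_{q'}(f',g')$ as $\mathbb F$-algebras if and only if $q=q'$ and the pair $(f',g')$ is obtained from $(f,g)$ by a finite sequence of transformations of the following three types: (I) $(f,g)\mapsto(f(h-\alpha)+\alpha,\ g(h-\alpha))$ for some $\alpha\in\mathbb F$; (II) $(f,g)\mapsto(\lambda f(\lambda^{-1}h),\ g(\lambda^{-1}h))$ for some $\lambda\in\mathbb F^*$; (III) $(f,g)\mapsto (f,\lambda\mu g)$ for some $\lambda,\mu\in\mathbb F^*$. In particular, in that case $\deg f=\deg f'$ and $\deg g=\deg g'$.
   Context: $\mathcal H_q(f,g)$ denotes the unital associative $\mathbb F$-algebra generated by $x,y,h$ with relations $hx=xf(h)$, $yh=f(h)y$, $yx-qxy=g(h)$ (quantum generalized Heisenberg algebra). *)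

(* Defs.v *)
From HB Require Import structures.
From mathcomp Require Import all_boot all_order all_algebra.
Set Implicit Arguments. Unset Strict Implicit. Unset Printing Implicit Defensive.
Import GRing.Theory.
Local Open Scope ring_scope.

Definition qgh_rel (F : fieldType) (A : algType F) (q : F) (f g : {poly F})
  (x y h : A) : Prop :=
  [/\ h * x = x * horner_alg h f,
      y * h = horner_alg h f * y
    & y * x - q *: (x * y) = horner_alg h g].

(* (A, x, y, h) is a presentation of H_q(f,g): the generators satisfy the
   relations, and A has the universal property of the unital associative
   F-algebra generated by x, y, h subject to these relations. *)
Definition is_qgh_presentation (F : fieldType) (q : F) (f g : {poly F})
  (A : algType F) (x y h : A) : Prop :=
  qgh_rel q f g x y h /\
  forall (B : algType F) (u v w : B), qgh_rel q f g u v w ->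
    (exists phi : {lrmorphism A -> B}, [/\ phi x = u, phi y = v & phi h = w]) /\
    (forall phi psi : {lrmorphism A -> B},
        phi x = psi x -> phi y = psi y -> phi h = psi h -> phi =1 psi).

Definition alg_iso (F : fieldType) (A A' : algType F) : Prop :=
  exists phi : {lrmorphism A -> A'}, bijective phi.

Inductive qgh_step (F : fieldType) : {poly F} * {poly F} -> {poly F} * {poly F} -> Prop :=
  | qgh_stepI (a : F) (f g : {poly F}) :
      qgh_step (f, g) (f \Po ('X - a%:P) + a%:P, g \Po ('X - a%:P))
  | qgh_stepII (l : F) (f g : {poly F}) : l != 0 ->
      qgh_step (f, g) (l *: (f \Po (l^-1 *: 'X)), g \Po (l^-1 *: 'X))
  | qgh_stepIII (l m : F) (f g : {poly F}) : l != 0 -> m != 0 ->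
      qgh_step (f, g) (f, (l * m) *: g).

Inductive qgh_reach (F : fieldType) : {poly F} * {poly F} -> {poly F} * {poly F} -> Prop :=
  | qgh_reach_refl p : qgh_reach p p
  | qgh_reach_step p p' p'' : qgh_step p p' -> qgh_reach p' p'' -> qgh_reach p p''.

(* Main.v *)
(** Every element of H_q(f,g) is uniquely a sum of x^i p_ij(h) y^j: the obvious
    action of the generators on such formal sums gives a representation, and
    the uniqueness part of the universal property makes evaluation of formal
    sums intertwine it with left multiplication.

    If q <> 0 and deg f >= 1, the total degree i + j of the lexicographically
    leading term is additive on products.  Let phi : H -> H' be an isomorphism
    and u = phi(h).  H is a domain, which forces q' <> 0 and deg f' >= 1.  Since
    u phi(x) = phi(x) f(u) and deg f >= 2, the degree of u is 0, i.e., u = p(h').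
    Comparing coefficients of x'^i _ y'^j then shows phi(x) in x'H' and
    phi(y) in H'y'.  The same holds for phi^-1, so p is affine and phi(x), phi(y)
    are scalar multiples of x', y'; hence p o f' = f o p, q = q' and
    g o p is a nonzero scalar multiple of g'.  This is precisely reachability by
    the transformations (I), (II), (III). *)
Require Import Defs.
From HB Require Import structures.
From mathcomp Require Import all_boot all_order all_algebra.
From mathcomp Require Import boolp.
Set Implicit Arguments. Unset Strict Implicit. Unset Printing Implicit Defensive.
Import GRing.Theory.
Local Open Scope ring_scope.

(** * Endomorphism algebras *)

Lemma lrmorph_horner_alg (F : fieldType) (A B : algType F)
    (phi : {lrmorphism A -> B}) a p :
  phi (horner_alg a p) = horner_alg (phi a) p.
Proof.
elim/poly_ind: p => [|p c IHp]; first by rewrite !rmorph0.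
by rewrite !(rmorphD, rmorphM) /= IHp !horner_algX !horner_algC rmorph_alg.
Qed.

Lemma qgh_rel_lrmorph (F : fieldType) (A B : algType F)
    (phi : {lrmorphism A -> B}) q f g x y h :
  qgh_rel q f g x y h -> qgh_rel q f g (phi x) (phi y) (phi h).
Proof.
case=> r1 r2 r3; split; rewrite -!lrmorph_horner_alg -!rmorphM ?r1 ?r2 //.
by rewrite -linearZ -raddfB /= r3.
Qed.

(** The universal property quantifies over [algType F], so the endomorphisms of V have to form a
    bundled algebra. The nonzero vector is a parameter because the ring structure requires 1 !=
    0. *)
Record lin_end (F : fieldType) (V : lmodType F) (ntV : exists v : V, v != 0) :=
  LinEnd { lin_fun :> V -> V; lin_funP : linear lin_fun }.

Section LinEnd.
Variables (F : fieldType) (V : lmodType F) (ntV : exists v : V, v != 0).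
Local Notation E := (lin_end ntV).

Lemma lin_end_eq (a b : E) : a =1 b -> a = b.
Proof.
case: a b => [a la] [b lb] /= /funext eqab.
by rewrite eqab in la *; congr LinEnd; exact: Prop_irrelevance.
Qed.

Lemma lin_endD (a : E) u v : a (u + v) = a u + a v.
Proof. by have := lin_funP a 1 u v; rewrite !scale1r. Qed.

Lemma lin_end0 (a : E) : a 0 = 0.
Proof. by apply: (addrI (a 0)); rewrite -lin_endD !addr0. Qed.

Lemma lin_endZ (a : E) k u : a (k *: u) = k *: a u.
Proof. by have := lin_funP a k u 0; rewrite lin_end0 !addr0. Qed.

HB.instance Definition _ := gen_eqMixin E.
HB.instance Definition _ := gen_choiceMixin E.

Fact zero_subproof : linear (fun _ : V => 0 : V).
Proof. by move=> k u v; rewrite scaler0 addr0. Qed.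
Fact add_subproof (a b : E) : linear (fun v => a v + b v).
Proof. by move=> k u v; rewrite !lin_funP scalerDr addrACA. Qed.
Fact opp_subproof (a : E) : linear (fun v => - a v).
Proof. by move=> k u v; rewrite lin_funP opprD scalerN. Qed.
Fact one_subproof : linear (fun v : V => v).
Proof. by []. Qed.
Fact mul_subproof (a b : E) : linear (fun v => a (b v)).
Proof. by move=> k u v; rewrite !lin_funP. Qed.
Fact scale_subproof c (a : E) : linear (fun v => c *: a v).
Proof. by move=> k u v; rewrite lin_funP scalerDr !scalerA mulrC. Qed.

Definition zero_end : E := LinEnd _ zero_subproof.
Definition add_end a b : E := LinEnd _ (add_subproof a b).
Definition opp_end a : E := LinEnd _ (opp_subproof a).
Definition one_end : E := LinEnd _ one_subproof.
Definition mul_end a b : E := LinEnd _ (mul_subproof a b).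
Definition scale_end c a : E := LinEnd _ (scale_subproof c a).

Fact add_endA : associative add_end.
Proof. by move=> a b c; apply: lin_end_eq => v /=; rewrite addrA. Qed.
Fact add_endC : commutative add_end.
Proof. by move=> a b; apply: lin_end_eq => v /=; rewrite addrC. Qed.
Fact add_end0 : left_id zero_end add_end.
Proof. by move=> a; apply: lin_end_eq => v /=; rewrite add0r. Qed.
Fact add_endN : left_inverse zero_end opp_end add_end.
Proof. by move=> a; apply: lin_end_eq => v /=; rewrite addNr. Qed.
HB.instance Definition _ :=
  GRing.isZmodule.Build E add_endA add_endC add_end0 add_endN.

Fact mul_endA : associative mul_end.
Proof. by move=> a b c; apply: lin_end_eq. Qed.
Fact mul_1end : left_id one_end mul_end.
Proof. by move=> a; apply: lin_end_eq. Qed.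
Fact mul_end1 : right_id one_end mul_end.
Proof. by move=> a; apply: lin_end_eq. Qed.
Fact mul_endDl : left_distributive mul_end +%R.
Proof. by move=> a b c; apply: lin_end_eq. Qed.
Fact mul_endDr : right_distributive mul_end +%R.
Proof. by move=> a b c; apply: lin_end_eq => v /=; rewrite lin_endD. Qed.
Fact one_end_neq0 : one_end != 0.
Proof.
by case: ntV => v; apply: contraNneq => /(congr1 (fun a : E => a v)) /= ->.
Qed.
HB.instance Definition _ := GRing.Zmodule_isNzRing.Build E
  mul_endA mul_1end mul_end1 mul_endDl mul_endDr one_end_neq0.

Fact scale_endA c d a : scale_end c (scale_end d a) = scale_end (c * d) a.
Proof. by apply: lin_end_eq => v /=; rewrite scalerA. Qed.
Fact scale_1end : left_id 1 scale_end.
Proof. by move=> a; apply: lin_end_eq => v /=; rewrite scale1r. Qed.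
Fact scale_endDr : right_distributive scale_end +%R.
Proof. by move=> c a b; apply: lin_end_eq => v /=; rewrite scalerDr. Qed.
Fact scale_endDl a : {morph scale_end^~ a : c d / c + d}.
Proof. by move=> c d; apply: lin_end_eq => v /=; rewrite scalerDl. Qed.
HB.instance Definition _ := GRing.Zmodule_isLmodule.Build F E
  scale_endA scale_1end scale_endDr scale_endDl.

Fact scale_endAl (c : F) (a b : E) : c *: (a * b) = (c *: a) * b.
Proof. exact: lin_end_eq. Qed.
HB.instance Definition _ := GRing.Lmodule_isLalgebra.Build F E scale_endAl.
Fact scale_endAr (c : F) (a b : E) : c *: (a * b) = a * (c *: b).
Proof. by apply: lin_end_eq => v /=; rewrite lin_endZ. Qed.
HB.instance Definition _ := GRing.Lalgebra_isAlgebra.Build F E scale_endAr.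

Lemma lin_end0E v : (0 : E) v = 0. Proof. by []. Qed.
Lemma lin_end1E v : (1 : E) v = v. Proof. by []. Qed.
Lemma lin_endDE (a b : E) v : (a + b) v = a v + b v. Proof. by []. Qed.
Lemma lin_endNE (a : E) v : (- a) v = - a v. Proof. by []. Qed.
Lemma lin_endME (a b : E) v : (a * b) v = a (b v). Proof. by []. Qed.
Lemma lin_endZE c (a : E) v : (c *: a) v = c *: a v. Proof. by []. Qed.

End LinEnd.

(** * Intertwining from the uniqueness half of the universal property *)

Section Intertwine.
Variables (F : fieldType) (q : F) (f g : {poly F}) (A : algType F) (x y h : A).
Hypothesis presA : is_qgh_presentation q f g x y h.
Variables (V : lmodType F) (ntV : exists v : V, v != 0).
Variables (rho : {lrmorphism A -> lin_end ntV}) (ev : {linear V -> A}).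

Let W := (V * A)%type.
Fact ntW : exists w : W, w != 0.
Proof. by exists (0, 1); apply/eqP => -[/eqP]; rewrite oner_eq0. Qed.

Fact diag_subproof (a : A) : linear (fun w : W => (rho a w.1, a * w.2) : W).
Proof.
move=> k [u1 u2] [v1 v2] /=.
by congr pair => /=; rewrite ?lin_funP // mulrDr scalerAr.
Qed.
Definition diag_act (a : A) : lin_end ntW := LinEnd _ (diag_subproof a).

(* The conjugate of [diag_act] by the shear [(v, b) |-> (v, b + ev v)]. *)
Fact shear_subproof (a : A) :
  linear (fun w : W => (rho a w.1, a * (w.2 + ev w.1) - ev (rho a w.1)) : W).
Proof.
move=> k [u1 u2] [v1 v2] /=; congr pair => /=; first exact: lin_funP.
by rewrite lin_funP !linearP /= addrACA -scalerDr mulrDr -scalerAr addrACA -scalerDr.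
Qed.
Definition shear_act (a : A) : lin_end ntW := LinEnd _ (shear_subproof a).

Fact diag_zmod : zmod_morphism diag_act.
Proof.
move=> a b; apply: lin_end_eq => -[v c] /=.
by rewrite raddfB mulrBl.
Qed.
Fact diag_monoid : monoid_morphism diag_act.
Proof.
split=> [|a b]; apply: lin_end_eq => -[v c] /=.
  by rewrite rmorph1 mul1r.
by rewrite rmorphM /= mulrA.
Qed.
Fact diag_scal : scalable diag_act.
Proof.
by move=> k a; apply: lin_end_eq => -[v c] /=; rewrite linearZ -scalerAl.
Qed.
HB.instance Definition _ := GRing.isZmodMorphism.Build _ _ diag_act diag_zmod.
HB.instance Definition _ := GRing.isMonoidMorphism.Build _ _ diag_act diag_monoid.
HB.instance Definition _ := GRing.isScalable.Build _ _ _ _ diag_act diag_scal.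

Fact shear_zmod : zmod_morphism shear_act.
Proof.
move=> a b; apply: lin_end_eq => -[v c] /=.
rewrite raddfB lin_endDE lin_endNE raddfB mulrBl.
by congr pair; rewrite /= !opprD !opprK addrACA.
Qed.
Fact shear_monoid : monoid_morphism shear_act.
Proof.
split=> [|a b]; apply: lin_end_eq => -[v c] /=.
  by rewrite rmorph1 mul1r lin_end1E addrK.
by rewrite rmorphM lin_endME subrK mulrA.
Qed.
Fact shear_scal : scalable shear_act.
Proof.
move=> k a; apply: lin_end_eq => -[v c] /=.
by rewrite linearZ lin_endZE linearZ -scalerAl -scalerBr.
Qed.
HB.instance Definition _ := GRing.isZmodMorphism.Build _ _ shear_act shear_zmod.
HB.instance Definition _ := GRing.isMonoidMorphism.Build _ _ shear_act shear_monoid.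
HB.instance Definition _ := GRing.isScalable.Build _ _ _ _ shear_act shear_scal.

(** Both [diag_act] and [shear_act] are algebra morphisms, and they agree at an element exactly when
    [ev] intertwines its two actions. Agreement at the generators spreads to all of A by uniqueness;
    the second component at [(v, 0)] reads off the claim. *)
Lemma intertwine :
  (forall v, ev (rho x v) = x * ev v) -> (forall v, ev (rho y v) = y * ev v) ->
  (forall v, ev (rho h v) = h * ev v) -> forall a v, ev (rho a v) = a * ev v.
Proof.
move=> evx evy evh a v; case: presA => _ univ.
have eqgen z : (forall v, ev (rho z v) = z * ev v) -> diag_act z = shear_act z.
  by move=> evz; apply: lin_end_eq => -[w c] /=; rewrite evz mulrDr addrK.
have relD : qgh_rel q f g (diag_act x) (diag_act y) (diag_act h).
  exact: (qgh_rel_lrmorph diag_act (proj1 presA)).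
have [_ uniq] := univ _ _ _ _ relD.
have /(_ a) := uniq diag_act shear_act (eqgen _ evx) (eqgen _ evy) (eqgen _ evh).
move=> /(congr1 (fun e : lin_end ntW => (e (v, 0)).2)) /= /eqP.
by rewrite mulr0 add0r eq_sym subr_eq0 => /eqP.
Qed.
End Intertwine.

(** * The standard module *)

Section PolySum.
Variables (R : nzRingType) (V : nmodType) (phi : nat -> R -> V).
(** Only additivity of [phi] in its coefficient is asked for, so the same sum serves the inner level
    (powers of y) and the outer level (powers of x) of evaluation. *)
Definition polysum (P : {poly R}) : V := \sum_(i < size P) phi i P`_i.
Hypotheses (phi0 : forall i, phi i 0 = 0).
Hypotheses (phiD : forall i, {morph phi i : a b / a + b}).

Lemma polysum_widen n (P : {poly R}) : (size P <= n)%N ->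
  polysum P = \sum_(i < n) phi i P`_i.
Proof.
move=> le_n; rewrite /polysum (big_ord_widen n (fun i => phi i P`_i)) //.
rewrite [RHS](bigID (fun i : 'I_n => i < size P)%N) /= [X in _ + X]big1 ?addr0 //.
by move=> i; rewrite -leqNgt => le_i; rewrite nth_default.
Qed.

Lemma polysumD P Q : polysum (P + Q) = polysum P + polysum Q.
Proof.
pose n := maxn (size P) (size Q).
rewrite !(@polysum_widen n) ?leq_maxl ?leq_maxr ?size_polyD //.
by rewrite -big_split /=; apply: eq_bigr => i _; rewrite coefD phiD.
Qed.

Lemma polysum0 : polysum 0 = 0.
Proof. by rewrite /polysum size_poly0 big_ord0. Qed.

Lemma polysumC c : polysum c%:P = phi 0 c.
Proof. by rewrite (@polysum_widen 1) ?size_polyC_leq1 // big_ord1 coefC. Qed.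

Lemma polysumMX P : polysum (P * 'X) = \sum_(i < size P) phi i.+1 P`_i.
Proof.
have [->|nzP] := eqVneq P 0; first by rewrite mul0r polysum0 size_poly0 big_ord0.
rewrite /polysum size_mulX // big_ord_recl coefMX phi0 add0r.
by apply: eq_bigr => i _; rewrite coefMX.
Qed.
End PolySum.

(* Formal sums of x^i p(h) y^j: the outer variable stands for x, the middle one
   for y and the inner one for h.  An alias is needed because {poly R} is only
   an R-module, whereas here the scalars must be F. *)
Definition pbw (F : fieldType) := {poly {poly {poly F}}}.

Section PBWModule.
Variable F : fieldType.
Local Notation T := (pbw F).
HB.instance Definition _ := GRing.Zmodule.on T.
Definition pbw_scale (c : F) (P : T) : T := (c%:P%:P : {poly {poly F}}) *: (P : {poly
  _}).
Fact pbw_scaleA c d P : pbw_scale c (pbw_scale d P) = pbw_scale (c * d) P.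
Proof. by rewrite /pbw_scale scalerA !polyCM. Qed.
Fact pbw_scale1 : left_id 1 pbw_scale.
Proof. by move=> P; rewrite /pbw_scale scale1r. Qed.
Fact pbw_scaleDr : right_distributive pbw_scale +%R.
Proof. by move=> c P Q; rewrite /pbw_scale scalerDr. Qed.
Fact pbw_scaleDl P : {morph pbw_scale^~ P : c d / c + d}.
Proof. by move=> c d; rewrite /pbw_scale !polyCD scalerDl. Qed.
HB.instance Definition _ := GRing.Zmodule_isLmodule.Build F T
  pbw_scaleA pbw_scale1 pbw_scaleDr pbw_scaleDl.

Lemma pbw_nt : exists P : T, P != 0.
Proof. by exists (1 : {poly _}); exact: oner_neq0. Qed.

Lemma pbw_coefZ c (P : T) i : (c *: P : T)`_i = c%:P *: P`_i.
Proof. by rewrite coefZ mul_polyC. Qed.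
End PBWModule.

Section PBW.
Variables (F : fieldType) (q : F) (f g : {poly F}).
Local Notation T := (pbw F).

(** The i-fold composite f_i of f with itself, which satisfies h x^i = x^i f_i(h) and y^i h = f_i(h)
    y^i. *)
Definition fiter i : {poly F} := iter i (comp_poly f) 'X.
Lemma fiterS i : fiter i.+1 = fiter i \Po f. Proof. by []. Qed.
Lemma fiterSr i : fiter i.+1 = f \Po fiter i.
Proof.
elim: i => [|i IHi]; first by rewrite /fiter /= comp_polyX comp_polyXr.
by rewrite fiterS {1}IHi -comp_polyA -fiterS.
Qed.

(* y x^i = q^i x^i y + x^(i-1) (qsum i)(h). *)
Fixpoint qsum i : {poly F} :=
  if i is i'.+1 then q *: qsum i' + (g \Po fiter i') else 0.

Lemma qsumS i : qsum i.+1 = q *: qsum i + (g \Po fiter i).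
Proof. by []. Qed.

(** Left multiplication by y on sums of p(h) y^j, from y p(h) = p(f(h)) y. *)
Definition ytwist (r : {poly {poly F}}) := map_poly (comp_poly f) r * 'X.
Lemma ytwist_is_additive : {morph ytwist : r s / r + s}.
Proof. by move=> r s; rewrite /ytwist rmorphD mulrDl. Qed.
Lemma ytwist0 : ytwist 0 = 0. Proof. by rewrite /ytwist rmorph0 mul0r. Qed.
Lemma ytwistZ p r : ytwist (p *: r) = (p \Po f) *: ytwist r.
Proof. by rewrite /ytwist -!mul_polyC rmorphM /= map_polyC /= mulrA. Qed.

Definition xact (P : T) : T := (P : {poly _}) * 'X.
Definition hact (P : T) : T := \poly_(i < size P) (fiter i *: P`_i).
(** For a formal sum of terms x^i r_i, the new coefficient of x^i receives q^i y r_i from x^i r_i,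
    and [qsum i.+1] times r_(i+1) from the remainder of y x^(i+1). *)
Definition yact (P : T) : T :=
  \poly_(i < size P) ((q ^+ i)%:P *: ytwist P`_i + qsum i.+1 *: P`_i.+1).

Lemma coef_xact P i : (xact P)`_i = if i is i'.+1 then P`_i' else 0.
Proof. by rewrite /xact coefMX; case: i. Qed.
Lemma coef_hact P i : (hact P)`_i = fiter i *: P`_i.
Proof.
by rewrite coef_poly; case: ltnP => // le_i; rewrite nth_default ?scaler0.
Qed.
Lemma coef_yact P i :
  (yact P)`_i = (q ^+ i)%:P *: ytwist P`_i + qsum i.+1 *: P`_i.+1.
Proof.
rewrite coef_poly; case: ltnP => // le_i.
by rewrite !nth_default ?ytwist0 ?scaler0 ?addr0 // leqW.
Qed.

Fact xact_linear : linear xact.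
Proof.
move=> c P Q; apply/polyP => i.
by rewrite coefD pbw_coefZ !coef_xact; case: i => [|i];
  rewrite ?scaler0 ?addr0 // coefD pbw_coefZ.
Qed.
Fact hact_linear : linear hact.
Proof.
move=> c P Q; apply/polyP => i.
by rewrite coefD pbw_coefZ !coef_hact coefD pbw_coefZ scalerDr !scalerA mulrC.
Qed.
Fact yact_linear : linear yact.
Proof.
move=> c P Q; apply/polyP => i.
rewrite coefD pbw_coefZ !coef_yact !coefD !pbw_coefZ ytwist_is_additive ytwistZ
  comp_polyC.
by rewrite !scalerDr !scalerA addrACA; do 2!congr (_ + _); rewrite mulrC.
Qed.

Definition xend : lin_end (pbw_nt F) := LinEnd _ xact_linear.
Definition hend : lin_end (pbw_nt F) := LinEnd _ hact_linear.
Definition yend : lin_end (pbw_nt F) := LinEnd _ yact_linear.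

Lemma coef_horner_hend p (P : T) i :
  (horner_alg hend p P)`_i = (p \Po fiter i) *: P`_i.
Proof.
elim/poly_ind: p P => [|p c IHp] P.
  by rewrite rmorph0 comp_poly0 scale0r lin_end0E coef0.
rewrite rmorphD rmorphM lin_endDE lin_endME coefD IHp /= horner_algX horner_algC
  lin_endZE.
rewrite pbw_coefZ coef_hact lin_end1E.
by rewrite comp_polyD comp_polyM comp_polyX comp_polyC scalerDl scalerA.
Qed.

(** In the third relation the [ytwist] terms cancel, as both carry the same power of q; what remains
    at x^i is [qsum i.+1] minus q times [qsum i], which is g o f_i by the recursion for [qsum]. *)
Lemma pbw_rel : qgh_rel q f g xend yend hend.
Proof.
split; apply: lin_end_eq => P; rewrite ?lin_endDE ?lin_endNE ?lin_endZE ?lin_endME /=;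
  apply/polyP => i.
- rewrite coef_hact !coef_xact; case: i => [|i]; rewrite ?scaler0 //.
  by rewrite coef_horner_hend fiterSr.
- rewrite coef_horner_hend !coef_yact !coef_hact ytwistZ scalerDr !scalerA.
  by rewrite -fiterSr fiterS ![_ * (_ \Po f)]mulrC.
- rewrite coefD coefN pbw_coefZ coef_horner_hend coef_yact !coef_xact.
  case: i => [|i].
    by rewrite ytwist0 !scaler0 subr0 add0r qsumS scaler0 add0r.
  rewrite coef_yact qsumS; move: (qsum i.+1) (g \Po _) => s r.
  rewrite -(mul_polyC q s) scalerDl scalerDr !scalerA exprS polyCM.
  by rewrite opprD addrACA subrr add0r addrAC subrr add0r.
Qed.
End PBW.

(** * The basis theorem *)

Section Eval.
Variables (F : fieldType) (A : algType F) (x y h : A).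
Local Notation T := (pbw F).

Definition yeval_coef (j : nat) (p : {poly F}) : A := horner_alg h p * y ^+ j.
Definition yeval (r : {poly {poly F}}) : A := polysum yeval_coef r.
Definition pbw_eval_coef (i : nat) (r : {poly {poly F}}) : A := x ^+ i * yeval r.
Definition pbw_eval (P : T) : A := polysum pbw_eval_coef P.

Lemma yeval_coef0 j : yeval_coef j 0 = 0.
Proof. by rewrite /yeval_coef rmorph0 mul0r. Qed.
Lemma yeval_coefD j : {morph yeval_coef j : p r / p + r}.
Proof. by move=> p r; rewrite /yeval_coef rmorphD mulrDl. Qed.
Lemma yevalD : {morph yeval : r s / r + s}.
Proof. by move=> r s; exact: (polysumD yeval_coef0 yeval_coefD). Qed.
Lemma yeval0 : yeval 0 = 0.
Proof. exact: polysum0. Qed.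
Lemma yeval_widen n (r : {poly {poly F}}) : (size r <= n)%N ->
  yeval r = \sum_(j < n) horner_alg h r`_j * y ^+ j.
Proof. exact: (polysum_widen yeval_coef0). Qed.

Lemma pbw_eval_coef0 i : pbw_eval_coef i 0 = 0.
Proof. by rewrite /pbw_eval_coef yeval0 mulr0. Qed.
Lemma pbw_eval_coefD i : {morph pbw_eval_coef i : r s / r + s}.
Proof. by move=> r s; rewrite /pbw_eval_coef yevalD mulrDr. Qed.
Lemma pbw_eval_widen n (P : T) : (size P <= n)%N ->
  pbw_eval P = \sum_(i < n) x ^+ i * yeval P`_i.
Proof. exact: (polysum_widen pbw_eval_coef0). Qed.

Lemma yevalZ p r : yeval (p *: r) = horner_alg h p * yeval r.
Proof.
rewrite (@yeval_widen (size r)) ?size_scale_leq // mulr_sumr.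
by apply: eq_bigr => j _; rewrite coefZ rmorphM mulrA.
Qed.

Lemma yevalC p : yeval p%:P = horner_alg h p.
Proof. by rewrite /yeval (polysumC yeval_coef0) /yeval_coef expr0 mulr1. Qed.

Lemma pbw_evalC r : pbw_eval (r%:P : {poly _}) = yeval r.
Proof. by rewrite /pbw_eval (polysumC pbw_eval_coef0) /pbw_eval_coef expr0 mul1r. Qed.

Fact pbw_eval_linear : linear pbw_eval.
Proof.
move=> c P Q; rewrite [LHS](polysumD pbw_eval_coef0 pbw_eval_coefD).
congr (_ + _); rewrite -[LHS]/(pbw_eval (c *: P)).
rewrite [LHS](@pbw_eval_widen (size P)) ?size_scale_leq // scaler_sumr.
apply: eq_bigr => i _; rewrite pbw_coefZ yevalZ horner_algC.
by rewrite -scalerAl mul1r scalerAr.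
Qed.
HB.instance Definition _ :=
  GRing.isLinear.Build F T A *:%R pbw_eval pbw_eval_linear.

Lemma pbw_eval_xact P : pbw_eval (xact P) = x * pbw_eval P.
Proof.
rewrite /pbw_eval /xact (polysumMX pbw_eval_coef0) mulr_sumr.
by apply: eq_bigr => i _; rewrite /pbw_eval_coef exprS mulrA.
Qed.

Variables (q : F) (f g : {poly F}).
Hypothesis relA : qgh_rel q f g x y h.

Lemma horner_mulx p : horner_alg h p * x = x * horner_alg h (p \Po f).
Proof.
case: relA => hx _ _; elim/poly_ind: p => [|p c IHp].
  by rewrite comp_poly0 !rmorph0 mul0r mulr0.
rewrite comp_polyD comp_polyM comp_polyX comp_polyC !(rmorphD, rmorphM) /=.
rewrite horner_algX !horner_algC mulrDl mulrDr -mulrA hx mulrA IHp mulrA.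
by rewrite -scalerAl -scalerAr mul1r mulr1.
Qed.

Lemma y_mul_horner p : y * horner_alg h p = horner_alg h (p \Po f) * y.
Proof.
case: relA => _ yh _; elim/poly_ind: p => [|p c IHp].
  by rewrite comp_poly0 !rmorph0 mul0r mulr0.
rewrite comp_polyD comp_polyM comp_polyX comp_polyC !(rmorphD, rmorphM) /=.
rewrite horner_algX !horner_algC mulrDl mulrDr [y * (_ * h)]mulrA IHp -[_ * y *
  h]mulrA yh mulrA.
by rewrite -scalerAl -scalerAr mul1r mulr1.
Qed.

Lemma horner_mulxn p i : horner_alg h p * x ^+ i = x ^+ i * horner_alg h (p \Po fiter
  f i).
Proof.
elim: i p => [|i IHi] p; first by rewrite expr0 mul1r mulr1 comp_polyXr.
by rewrite exprSr mulrA IHi -[LHS]mulrA horner_mulx mulrA -comp_polyA -fiterS.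
Qed.

Lemma yn_mul_horner p j : y ^+ j * horner_alg h p = horner_alg h (p \Po fiter f j) *
  y ^+ j.
Proof.
elim: j p => [|j IHj] p; first by rewrite expr0 mul1r mulr1 comp_polyXr.
by rewrite exprS -mulrA IHj mulrA y_mul_horner -[LHS]mulrA -comp_polyA -fiterS.
Qed.

(** The induction moves g(h) past x^i, turning it into g(f_i(h)). At i = 0 the truncated exponent is
    harmless since [qsum] vanishes there. *)
Lemma y_mulxn i :
  y * x ^+ i = q ^+ i *: (x ^+ i * y) + x ^+ i.-1 * horner_alg h (qsum q f g i).
Proof.
elim: i => [|i IHi]; first by rewrite !expr0 scale1r mul1r mulr1 rmorph0 mulr0 addr0.
case: (relA) => _ _ yx; have {}yx : y * x = q *: (x * y) + horner_alg h g.
  by rewrite -yx addrC subrK.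
rewrite exprS mulrA yx mulrDl -scalerAl -[x * y * _]mulrA IHi horner_mulxn mulrDr
  scalerDr.
rewrite -scalerAr scalerA -addrA -exprS [x * (_ * y)]mulrA -!exprS; congr (_ + _).
rewrite qsumS rmorphD mulrDr /=; congr (_ + _).
rewrite linearZ /= mulr_algl -scalerAr mulrA.
by case: i {IHi} => [|i]; rewrite /= ?rmorph0 ?mulr0 // -exprS.
Qed.

Lemma pbw_eval_hact P : pbw_eval (hact f P) = h * pbw_eval P.
Proof.
rewrite (@pbw_eval_widen (size P)) ?size_poly // mulr_sumr.
apply: eq_bigr => i _; rewrite coef_hact yevalZ !mulrA.
by rewrite -{2}(horner_algX h) horner_mulxn comp_polyX.
Qed.

Lemma yeval_twist r : yeval (ytwist f r) = y * yeval r.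
Proof.
rewrite /yeval /ytwist (polysumMX yeval_coef0) -/(yeval r).
rewrite (@yeval_widen (size r)) // mulr_sumr.
(* Composition with f may kill leading coefficients when f is constant, so the sum is extended to
   the size of r by zero terms. *)
rewrite (big_ord_widen _ (fun i => yeval_coef i.+1 (map_poly (comp_poly f) r)`_i)
  (size_poly _ _)).
rewrite big_mkcond /=; apply: eq_bigr => j _;
  rewrite /yeval_coef coef_map /= mulrA y_mul_horner.
case: ifP => [_|/negbT]; first by rewrite exprS mulrA.
rewrite -leqNgt => le_j; have := nth_default 0 le_j; rewrite coef_map /= => ->.
by rewrite rmorph0 !mul0r.
Qed.

Lemma pbw_eval_yact P : pbw_eval (yact q f g P) = y * pbw_eval P.
Proof.
rewrite (@pbw_eval_widen (size P)) ?size_poly // mulr_sumr.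
under [RHS]eq_bigr => i _.
  rewrite mulrA y_mulxn mulrDl -scalerAl -[X in q ^+ i *: X]mulrA -yeval_twist -mulrA
    -yevalZ; over.
under [LHS]eq_bigr => i _.
  rewrite coef_yact yevalD yevalZ horner_algC mulrDr -scalerAl mul1r -scalerAr; over.
rewrite /= !big_split /=; congr (_ + _).
(* Index shift: the sum over one more index loses its first term because [qsum] vanishes at 0 and
   its last because P has no coefficient there. *)
pose psi i := x ^+ i.-1 * yeval (qsum q f g i *: P`_i).
transitivity (\sum_(i < (size P).+1) psi i).
  by rewrite big_ord_recl [psi _]/psi scale0r yeval0 mulr0 add0r.
by rewrite big_ord_recr /= [psi (size P)]/psi nth_default // scaler0 yeval0 mulr0 addr0.
Qed.
End Eval.

Section Basis.
Variables (F : fieldType) (q : F) (f g : {poly F}) (A : algType F) (x y h : A).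
Hypothesis presA : is_qgh_presentation q f g x y h.
Local Notation T := (pbw F).
Local Notation relA := (proj1 presA).

Lemma pbw_rep : exists rho : {lrmorphism A -> lin_end (pbw_nt F)},
  [/\ rho x = xend F, rho y = yend q f g & rho h = hend f].
Proof. by case: presA => _ /(_ _ _ _ _ (pbw_rel q f g)) []. Qed.

Variable rho : {lrmorphism A -> lin_end (pbw_nt F)}.
Hypotheses (rhox : rho x = xend F) (rhoy : rho y = yend q f g) (rhoh : rho h = hend f).

Definition pbw_coord (a : A) : T := rho a (1 : {poly _}).

Lemma pbw_eval_rho a P : pbw_eval x y h (rho a P) = a * pbw_eval x y h P.
Proof.
apply: (intertwine presA) => {a P} P /=; rewrite ?rhox ?rhoy ?rhoh /=.
- exact: pbw_eval_xact.
- exact: (pbw_eval_yact relA).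
- exact: (pbw_eval_hact relA).
Qed.

(** Spanning half of the basis theorem: evaluation intertwines the actions and sends the formal sum
    1 to 1, so evaluating a acting on 1 gives back a. *)
Lemma pbw_coordK : cancel pbw_coord (pbw_eval x y h).
Proof.
by move=> a; rewrite pbw_eval_rho -[1]polyC1 pbw_evalC -polyC1 yevalC rmorph1 mulr1.
Qed.

Lemma rho_xn i (P : T) : rho (x ^+ i) P = (P : {poly _}) * 'X^i.
Proof.
elim: i => [|i IHi]; first by rewrite rmorph1 expr0 mulr1.
by rewrite exprS rmorphM /= IHi rhox /= /xact exprSr mulrA.
Qed.

Lemma coef_rho_horner p (P : T) i :
  (rho (horner_alg h p) P)`_i = (p \Po fiter f i) *: P`_i.
Proof. by rewrite lrmorph_horner_alg rhoh coef_horner_hend. Qed.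

Lemma rho_sum I (r : seq I) (E : I -> A) P :
  rho (\sum_(i <- r) E i) P = \sum_(i <- r) rho (E i) P.
Proof.
elim/big_rec2: _ => [|i Q a _ <-]; first by rewrite rmorph0.
by rewrite rmorphD lin_endDE.
Qed.

Lemma rho_yn1 j : rho (y ^+ j) (1 : {poly _}) = (('X^j : {poly {poly F}})%:P : {poly
  _}).
Proof.
elim: j => [|j IHj]; first by rewrite rmorph1 expr0.
rewrite exprS rmorphM /= IHj rhoy; apply/polyP => i.
rewrite coef_yact !coefC /= scaler0 addr0; case: i => [|i] /=.
  by rewrite expr0 scale1r /ytwist map_polyXn -exprSr.
by rewrite ytwist0 scaler0.
Qed.

Lemma rho_hornerC p (r : {poly {poly F}}) :
  rho (horner_alg h p) (r%:P : {poly _}) = ((p *: r)%:P : {poly _}).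
Proof.
apply/polyP => i; rewrite coef_rho_horner !coefC.
by case: i => [|i] /=; rewrite ?scaler0 // comp_polyXr.
Qed.

(** Independence half of the basis theorem: x^i p(h) y^j sends the formal sum 1 to that very
    monomial, since p(h) acts before any x is present. *)
Lemma pbw_evalK : cancel (pbw_eval x y h) pbw_coord.
Proof.
have rho_yeval r : rho (yeval y h r) (1 : {poly _}) = (r%:P : {poly _}).
  rewrite /yeval /polysum rho_sum -[r in RHS]coefK poly_def rmorph_sum.
  by apply: eq_bigr => j _; rewrite rmorphM /= rho_yn1 rho_hornerC.
move=> P; rewrite /pbw_coord /pbw_eval /polysum rho_sum -[RHS]coefK poly_def.
by apply: eq_bigr => i _; rewrite rmorphM /= rho_yeval rho_xn mul_polyC.
Qed.
End Basis.

(** * Leading terms *)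

Section Degree.
Variables (F : fieldType) (q : F) (f g : {poly F}).
Hypotheses (nzq : q != 0) (ncf : (1 < size f)%N).
Local Notation T := (pbw F).

Lemma deg_fiter i : (size (fiter f i)).-1 = ((size f).-1 ^ i)%N.
Proof.
elim: i => [|i IHi]; first by rewrite size_polyX.
by rewrite fiterS size_comp_poly IHi expnSr.
Qed.

Lemma size_fiter i : (1 < size (fiter f i))%N.
Proof.
have: (0 < (size (fiter f i)).-1)%N by rewrite deg_fiter expn_gt0 -subn1 subn_gt0 ncf.
by case: (size _) => [|[]].
Qed.

Lemma size_ytwist r : r != 0 -> size (ytwist f r) = (size r).+1.
Proof.
move=> nzr; have inj_f : injective (comp_poly f).
  by apply: raddf_inj => p /eqP; rewrite comp_poly_eq0 // => /eqP.
have sz : size (map_poly (comp_poly f) r) = size r.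
  by rewrite size_map_inj_poly ?comp_poly0.
by rewrite /ytwist size_mulX ?sz // -size_poly_eq0 sz size_poly_eq0.
Qed.

(** The action of y on the coefficient of x^n, modulo lower powers of x. *)
Definition qtwist n r := (q ^+ n)%:P *: ytwist f r.

Lemma size_qtwist n j r : r != 0 -> size (iter j (qtwist n) r) = (size r + j)%N.
Proof.
move=> nzr; elim: j => [|j IHj]; first by rewrite addn0.
rewrite iterS {1}/qtwist size_scale ?polyC_eq0 ?expf_neq0 //.
rewrite size_ytwist ?IHj ?addnS // -size_poly_eq0 IHj addn_eq0 size_poly_eq0.
by rewrite (negPf nzr).
Qed.

(** The coefficient of x^(m+n) in the product of x^m r and x^n s: moving r past x^n replaces h by
    f_n(h) and each y by [qtwist n]. *)
Definition top_coef n (r s : {poly {poly F}}) :=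
  \sum_(j < size r) (r`_j \Po fiter f n) *: iter j (qtwist n) s.

(** The last summand has the strictly largest y-degree. It survives because q is nonzero and
    composition with a nonconstant polynomial is injective. *)
Lemma size_top_coef n r s : r != 0 -> s != 0 ->
  size (top_coef n r s) = (size r + size s).-1.
Proof.
move=> nzr nzs; rewrite /top_coef (polySpred nzr) big_ord_recr /= addrC.
have sz : size ((r`_(size r).-1 \Po fiter f n) *: iter (size r).-1 (qtwist n) s)
         = (size s + (size r).-1)%N.
  rewrite size_scale ?size_qtwist // comp_poly_eq0 ?size_fiter //.
  by rewrite -lead_coefE lead_coef_eq0.
rewrite size_polyDl sz; first by rewrite addnC.
apply: leq_ltn_trans (size_sum _ _ _) _.
have pos : (0 < size s + (size r).-1)%N by rewrite addn_gt0 size_poly_gt0 nzs.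
rewrite -(prednK pos) ltnS; apply/bigmax_leqP => j _.
apply: leq_trans (size_scale_leq _ _) _.
by rewrite size_qtwist // -ltnS prednK // ltn_add2l.
Qed.

Variables (A : algType F) (x y h : A).
Variable rho : {lrmorphism A -> lin_end (pbw_nt F)}.
Hypotheses (rhox : rho x = xend F) (rhoy : rho y = yend q f g) (rhoh : rho h = hend f).

Lemma size_rho_yn j Q : (size (rho (y ^+ j) Q) <= size Q)%N.
Proof.
elim: j => [|j IHj]; first by rewrite rmorph1.
by rewrite exprS rmorphM /= rhoy (leq_trans (size_poly _ _)).
Qed.

Lemma coef_rho_yn j n (Q : T) : (size Q <= n.+1)%N ->
  (rho (y ^+ j) Q)`_n = iter j (qtwist n) Q`_n.
Proof.
move=> leQ; elim: j => [|j IHj]; first by rewrite rmorph1.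
rewrite exprS rmorphM /= rhoy coef_yact IHj [X in _ + X](_ : _ = 0) ?addr0 //.
by rewrite nth_default ?scaler0 // (leq_trans (size_rho_yn _ _)).
Qed.

Lemma size_rho_yeval r Q : (size (rho (yeval y h r) Q) <= size Q)%N.
Proof.
apply/leq_sizeP => i le_i; rewrite /yeval /polysum rho_sum coef_sum big1 // => j _.
rewrite rmorphM /= (coef_rho_horner rhoh) [(rho _ _)`__]nth_default ?scaler0 //.
exact: leq_trans (size_rho_yn _ _) le_i.
Qed.

Lemma coef_rho_yeval r n (Q : T) : (size Q <= n.+1)%N ->
  (rho (yeval y h r) Q)`_n = top_coef n r Q`_n.
Proof.
move=> leQ; rewrite /yeval /polysum rho_sum coef_sum; apply: eq_bigr => j _.
by rewrite rmorphM /= (coef_rho_horner rhoh) coef_rho_yn.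
Qed.

(** Neither y nor h raises the x-degree, so x^(m+n) arises only from the leading terms in x of P and
    Q. *)
Lemma rho_pbw_eval (P Q : T) (m := (size P).-1) (n := (size Q).-1) :
  (size (rho (pbw_eval x y h P) Q) <= (m + n).+1)%N /\
  (rho (pbw_eval x y h P) Q)`_(m + n) = top_coef n (lead_coef P) (lead_coef Q).
Proof.
have leQ : (size Q <= n.+1)%N by rewrite /n; case: (size Q).
have rhoE : rho (pbw_eval x y h P) Q
    = \sum_(i < m.+1) (rho (yeval y h P`_i) Q : {poly _}) * 'X^i.
  rewrite (@pbw_eval_widen _ _ _ _ _ m.+1); last by rewrite /m; case: (size P).
  by rewrite rho_sum; apply: eq_bigr => i _; rewrite rmorphM /= (rho_xn rhox).
have coef0 r i : (n < i)%N -> (rho (yeval y h r) Q)`_i = 0.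
  by move=> lt_i;
    rewrite nth_default // (leq_trans (size_rho_yeval _ _)) ?(leq_trans leQ).
rewrite rhoE; split.
  apply/leq_sizeP => k lt_k; rewrite coef_sum big1 // => i _.
  rewrite coefMXn; case: ltnP => // _; apply: coef0.
  by rewrite ltn_subRL (leq_trans _ lt_k) // ltnS leq_add2r -ltnS.
rewrite coef_sum big_ord_recr /= big1 ?add0r => [|i _].
  by rewrite coefMXn ltnNge leq_addr /= addKn coef_rho_yeval.
rewrite coefMXn; case: ltnP => // _; apply: coef0.
by rewrite ltn_subRL ltn_add2r.
Qed.
End Degree.

Section Consequences.
Variables (F : fieldType) (q : F) (f g : {poly F}) (A : algType F) (x y h : A).
Hypothesis presA : is_qgh_presentation q f g x y h.
Local Notation T := (pbw F).

Lemma pbw_eval_inj : injective (pbw_eval x y h).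
Proof. by have [rho [rx ry rh]] := pbw_rep presA;
  apply: can_inj (pbw_evalK rx ry rh). Qed.

Lemma pbw_eval_surj a : exists P, a = pbw_eval x y h P.
Proof.
have [rho [rx ry rh]] := pbw_rep presA.
by exists (pbw_coord rho a); rewrite (pbw_coordK presA rx ry rh).
Qed.

Lemma horner_alg_inj : injective (horner_alg h).
Proof.
move=> p r; rewrite -!(yevalC y) -!(pbw_evalC x) => /pbw_eval_inj.
by move/polyC_inj/polyC_inj.
Qed.

(** The degree is exported only through these properties: additivity together with the absence of
    zero divisors, value 0 exactly on polynomials in h, and stability of a positive value under
    adding scalars. *)
Lemma qgh_degree : q != 0 -> (1 < size f)%N -> exists D : A -> nat,
  [/\ forall a b, a != 0 -> b != 0 -> a * b != 0 /\ D (a * b) = (D a + D b)%N,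
      forall a, D a = 0%N -> exists p, a = horner_alg h p,
      forall p, D (horner_alg h p) = 0%N
    & forall a c, (0 < D a)%N -> D (a + c%:A) = D a].
Proof.
move=> nzq ncf; have [rho [rx ry rh]] := pbw_rep presA.
pose co := pbw_coord rho; pose ev := pbw_eval x y h.
have coK : cancel co ev := pbw_coordK presA rx ry rh.
have evK : cancel ev co := pbw_evalK rx ry rh.
have co0 : co 0 = 0 by rewrite /co /pbw_coord rmorph0.
have co_eq0 a : (co a == 0) = (a == 0).
  by apply/eqP/eqP => [|->//]; rewrite -{2}[a]coK => ->; rewrite /ev raddf0.
(* D a is i + j for the lexicographically leading term x^i p(h) y^j of a. *)
pose D a := ((size (co a)).-1 + (size (lead_coef (co a))).-1)%N.
exists D; split=> [a b nza nzb | a Da | p | a c Da].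
- pose r := lead_coef (co a); pose s := lead_coef (co b).
  have nzr : r != 0 by rewrite lead_coef_eq0 co_eq0.
  have nzs : s != 0 by rewrite lead_coef_eq0 co_eq0.
  have [] := rho_pbw_eval rx ry rh (co a) (co b).
  rewrite -/r -/s -/(ev (co a)) coK.
  have -> : rho a (co b) = co (a * b) by rewrite /co /pbw_coord rmorphM.
  set m := _.-1; set n := _.-1 => le_sz cf.
  have sz_top := size_top_coef nzq ncf n nzr nzs.
  have nz_top : top_coef q f n r s != 0.
    by rewrite -size_poly_gt0 sz_top (polySpred nzr) (polySpred nzs) addnS.
  have sz : size (co (a * b)) = (m + n).+1.
    by apply/eqP; rewrite eqn_leq le_sz ltnNge;
      apply: contraNN nz_top => /leq_sizeP/(_ _ (leqnn _)); rewrite cf => ->.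
  split; first by rewrite -co_eq0 -size_poly_eq0 sz.
  rewrite /D lead_coefE sz /= cf sz_top -/r -/s -/m -/n addnACA; congr (_ + _)%N.
  by rewrite (polySpred nzr) (polySpred nzs) addnS.
- have [->|nza] := eqVneq a 0; first by exists 0; rewrite rmorph0.
  move: Da => /eqP; rewrite addn_eq0 => /andP[/eqP Dx /eqP Dy].
  have nzP : co a != 0 by rewrite co_eq0.
  have nzr : lead_coef (co a) != 0 by rewrite lead_coef_eq0.
  have Pa : co a = (lead_coef (co a))%:P.
    by rewrite lead_coefE Dx; apply: size1_polyC; rewrite (polySpred nzP) Dx.
  have ra : lead_coef (co a) = ((lead_coef (co a))`_0)%:P.
    by apply: size1_polyC; rewrite (polySpred nzr) Dy.
  move: (lead_coef _) nzr Dy Pa ra => r _ _ Pa ra; exists r`_0.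
  by rewrite -[LHS]coK Pa {1}ra /ev pbw_evalC yevalC.
- rewrite /D -(yevalC y) -(pbw_evalC x) -/(ev _) evK lead_coefC !size_polyC.
  by case: eqP => // _; case: eqP.
- have coc : co (a + c%:A) = (co a : {poly _}) + (c%:P%:P%:P : {poly {poly {poly F}}}).
    rewrite /co /pbw_coord rmorphD /= rmorph_alg.
    by congr (_ + _); exact: alg_polyC.
  have le1 (R : nzRingType) (r : R) : (size r%:P <= 1)%N := size_polyC_leq1 r.
  (* A scalar lies strictly below the leading term if the x-degree is positive; otherwise the
     y-degree must be, and the same holds one level down. *)
  have [lt1|le_1] := ltnP 1 (size (co a)).
    by rewrite /D coc size_polyDl ?lead_coefDl ?(leq_ltn_trans (le1 _ _)).
  have Pa := size1_polyC le_1; rewrite /D coc; move: Da;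
    rewrite /D Pa -polyCD !lead_coefC !size_polyC.
  set r := _`_0; have [->|nzr] := eqVneq r 0; first by rewrite size_poly0.
  move=> lt0; rewrite size_polyDl; last first.
    by apply: leq_ltn_trans (le1 _ _) _; move: lt0; case: (size r) => [|[]].
  by case: (_ != 0).
Qed.
End Consequences.

(** * Zero divisors and intertwiners *)

Lemma horner_alg_comp (F : fieldType) (A : algType F) (h : A) p r :
  horner_alg (horner_alg h p) r = horner_alg h (r \Po p).
Proof.
elim/poly_ind: r => [|r c IHr]; first by rewrite comp_poly0 !rmorph0.
rewrite comp_polyD comp_polyM comp_polyX comp_polyC !(rmorphD, rmorphM) /=.
by rewrite IHr horner_algX !horner_algC.
Qed.

Lemma dvdp_comp_exists (F : fieldType) (f g : {poly F}) : g != 0 ->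
  exists r s, r != 0 /\ r \Po f = s * g.
Proof.
move=> nzg; pose n := (size g).-1.
(* The n + 1 powers 1, f, ..., f^n are linearly dependent modulo g. *)
pose M : 'M[F]_(n.+1, n) := \matrix_(i < n.+1) poly_rV (f ^+ i %% g).
have : kermx M != 0.
  by rewrite kermx_eq0 /row_free neq_ltn ltnS rank_leq_col.
case/rowV0Pn => v /sub_kermxP vM nzv.
exists (rVpoly v), (\sum_(i < n.+1) v 0 i *: (f ^+ i %/ g)); split.
  by apply: contraNneq nzv => v0; rewrite -[v]rVpolyK v0 linear0.
have -> : rVpoly v \Po f = \sum_(i < n.+1) v 0 i *: f ^+ i.
  rewrite comp_polyE (big_ord_widen n.+1 (fun i => (rVpoly v)`_i *: f ^+ i))
    ?size_poly //.
  rewrite big_mkcond; apply: eq_bigr => i _; rewrite coef_rVpoly_ord.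
  case: ltnP => // le_i; rewrite -coef_rVpoly_ord nth_default ?scale0r //.
have modM : \sum_(i < n.+1) v 0 i *: (f ^+ i %% g) = 0.
  transitivity (rVpoly (v *m M)); last by rewrite vM linear0.
  rewrite mulmx_sum_row linear_sum; apply: eq_bigr => i _.
  rewrite linearZ /= rowK poly_rV_K //; move: (ltn_modp (f ^+ i) g).
  by rewrite nzg (polySpred nzg) ltnS.
rewrite -[RHS]addr0 -[X in _ = _ + X]modM mulr_suml -big_split;
  apply: eq_bigr => i _ /=.
by rewrite -scalerAl -scalerDr -divp_eq.
Qed.

Section Intertwiners.
Variables (F : fieldType) (q : F) (f g : {poly F}) (A : algType F) (x y h : A).
Hypothesis presA : is_qgh_presentation q f g x y h.
Local Notation T := (pbw F).
Local Notation ev := (pbw_eval x y h).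
Local Notation relA := (proj1 presA).

Lemma pbw_eval1 : ev (1 : {poly _}) = 1.
Proof. by rewrite -[1]polyC1 pbw_evalC -polyC1 yevalC rmorph1. Qed.

Lemma yevalMX r : yeval y h (r * 'X) = yeval y h r * y.
Proof.
rewrite /yeval (polysumMX (yeval_coef0 _ _)) mulr_suml; apply: eq_bigr => j _.
by rewrite /yeval_coef exprSr mulrA.
Qed.

Lemma gen_y_eval : y = ev (('X%:P : {poly _})).
Proof. by rewrite pbw_evalC -['X]mul1r yevalMX -polyC1 yevalC rmorph1 mul1r. Qed.

Lemma gen_x_eval : x = ev ('X : {poly _}).
Proof. by rewrite -['X]mul1r [RHS]pbw_eval_xact pbw_eval1 mulr1. Qed.

Lemma pbw_eval_neq0 (P : T) : P != 0 -> ev P != 0.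
Proof. by apply: contra_neq => P0; apply: (pbw_eval_inj presA); rewrite P0 raddf0. Qed.

Lemma gen_y_neq0 : y != 0.
Proof. by rewrite gen_y_eval pbw_eval_neq0 // polyC_eq0 polyX_eq0. Qed.

Lemma gen_x_neq0 : x != 0.
Proof. by rewrite gen_x_eval pbw_eval_neq0 // polyX_eq0. Qed.

Lemma gen_h_nonscalar c : h != c%:A.
Proof.
rewrite -(horner_algC h) -{1}(horner_algX h); apply/eqP => /(horner_alg_inj presA) eqX.
by have := size_polyX F; rewrite eqX => sz; have := size_polyC_leq1 c; rewrite sz.
Qed.

(* For q = 0 and r o f = s g, one has (x y) (r(h) - x s(h) y) = 0. *)
Lemma qgh_zero_divisor : q = 0 \/ (size f <= 1)%N ->
  exists a b : A, [/\ a != 0, b != 0 & a * b = 0].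
Proof.
have [hx yh yx] := relA.
case=> [q0 | /size1_polyC fc]; last first.
  (* If f is a constant c, then h x = c x, that is, (h - c) x = 0. *)
  exists (horner_alg h ('X - (f`_0)%:P)), x; split; last 1 first.
  - rewrite rmorphB mulrBl /= horner_algX hx {1}fc !horner_algC.
    by rewrite -scalerAr -scalerAl mulr1 mul1r subrr.
  - rewrite -(rmorph0 (horner_alg h)) (inj_eq (horner_alg_inj presA)).
    by rewrite polyXsubC_eq0.
  - exact: gen_x_neq0.
have {}yx : y * x = horner_alg h g by rewrite -yx q0 scale0r subr0.
have [g0|nzg] := eqVneq g 0.
  by exists y, x; split; rewrite ?gen_x_neq0 ?gen_y_neq0 // yx g0 rmorph0.
have [r [s [nzr rfE]]] := dvdp_comp_exists f nzg.
exists (x * y), (horner_alg h r - x * (horner_alg h s * y)); split; last 1 first.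
- rewrite mulrBr -mulrA (y_mul_horner relA) rfE mulrC rmorphM /= -yx.
  by rewrite !mulrA subrr.
- rewrite gen_y_eval -pbw_eval_xact pbw_eval_neq0 //.
  by rewrite mulf_neq0 ?polyC_eq0 ?polyX_eq0.
- have -> : horner_alg h r - x * (horner_alg h s * y)
      = ev ((r%:P%:P : {poly {poly _}}) - ((s *: 'X)%:P : {poly {poly _}}) * 'X).
    rewrite raddfB /= -/(xact _) pbw_eval_xact !pbw_evalC yevalC yevalZ.
    by rewrite -(mul1r 'X) yevalMX -polyC1 yevalC rmorph1 mul1r.
  (* The coefficient of x^0 in the second factor is r, so that factor is nonzero. *)
  apply: pbw_eval_neq0; apply: contraNneq nzr => P0.
  have : (r%:P%:P - (s *: 'X)%:P * 'X : {poly {poly {poly F}}})`_0 = 0.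
    by rewrite P0 coef0.
  by rewrite coefB coefMX coefC subr0 => /eqP; rewrite polyC_eq0.
Qed.

Lemma horner_mul_eval p (P : T) :
  horner_alg h p * ev P = ev (\poly_(i < size P) ((p \Po fiter f i) *: P`_i)).
Proof.
rewrite (@pbw_eval_widen _ _ _ _ _ (size P)) // mulr_sumr.
rewrite [RHS](@pbw_eval_widen _ _ _ _ _ (size P)) ?size_poly //.
apply: eq_bigr => i _; rewrite coef_poly ltn_ord yevalZ !mulrA.
by rewrite (horner_mulxn relA).
Qed.

Lemma eval_mul_horner p (P : T) :
  ev P * horner_alg h p
  = ev (\poly_(i < size P) \poly_(j < size P`_i) (P`_i`_j * (p \Po fiter f j))).
Proof.
rewrite (@pbw_eval_widen _ _ _ _ _ (size P)) // mulr_suml.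
rewrite [RHS](@pbw_eval_widen _ _ _ _ _ (size P)) ?size_poly //.
apply: eq_bigr => i _; rewrite coef_poly ltn_ord -mulrA; congr (_ * _).
rewrite (@yeval_widen _ _ _ _ (size P`_i)) // mulr_suml.
rewrite [RHS](@yeval_widen _ _ _ _ (size P`_i)) ?size_poly //.
apply: eq_bigr => j _; rewrite coef_poly ltn_ord rmorphM -!mulrA.
by rewrite (yn_mul_horner relA).
Qed.

(** Moving p(h) right past x^i gives p(f_i(h)), and moving r(h) left past y^j gives r(f_j(h)).
    Coordinates being unique, both multiply the same nonzero coefficient to the same result. *)
Lemma eval_intertwine p r (P : T) :
  horner_alg h p * ev P = ev P * horner_alg h r ->
  forall i j, P`_i`_j != 0 -> p \Po fiter f i = r \Po fiter f j.
Proof.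
rewrite horner_mul_eval eval_mul_horner => /(pbw_eval_inj presA) eqQ i j nzP.
have lt_j : (j < size (P`_i)%R)%N by rewrite ltnNge; apply: contraNN nzP => le;
  rewrite nth_default.
have lt_i : (i < size P)%N.
  by rewrite ltnNge; apply: contraNN nzP => le; rewrite (nth_default 0 le) coef0.
have := congr1 (fun Q : {poly {poly {poly F}}} => Q`_i`_j) eqQ.
by rewrite !coef_poly lt_i coefZ coef_poly lt_j mulrC => /(mulfI nzP).
Qed.
End Intertwiners.

(** * Rigidity *)

Section Rigidity.
Variables (F : fieldType) (q : F) (f g : {poly F}) (A : algType F) (x y h : A).
Hypothesis presA : is_qgh_presentation q f g x y h.
Hypotheses (nzq : q != 0) (ncf : (1 < size f)%N).
Local Notation T := (pbw F).
Local Notation ev := (pbw_eval x y h).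

Lemma qgh_domain (a b : A) : a != 0 -> b != 0 -> a * b != 0.
Proof.
have [D [DM _ _ _]] := qgh_degree presA nzq ncf.
by move=> nza nzb; case: (DM a b nza nzb).
Qed.

(** Additivity of the degree puts both factors in F[h], whose units are the nonzero constants. *)
Lemma qgh_mul1_scalar (a b : A) : a * b = 1 -> exists2 c, c != 0 & a = c%:A.
Proof.
have [D [DM D0 Dh _]] := qgh_degree presA nzq ncf.
move=> ab1; have nz : a * b != 0 by rewrite ab1 oner_eq0.
have nza : a != 0 by apply: contraNneq nz => ->; rewrite mul0r.
have nzb : b != 0 by apply: contraNneq nz => ->; rewrite mulr0.
have D1 : D 1 = 0%N by rewrite -(rmorph1 (horner_alg h)) Dh.
have [_] := DM a b nza nzb; rewrite ab1 D1.
move=> /esym/eqP; rewrite addn_eq0 => /andP[/eqP/D0[p ap] /eqP/D0[r br]].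
have pr1 : p * r = 1.
  by apply: (horner_alg_inj presA); rewrite rmorphM rmorph1 /= -ap -br.
have: size (p * r) == 1%N by rewrite pr1 size_poly1.
rewrite size_mul_eq1 => /andP[/size_poly1P[c nzc pc] _].
by exists c; rewrite // ap pc horner_algC.
Qed.

(** Comparing degrees in u v = v f0(u) gives D(u) = deg(f0) D(u); as deg f0 >= 2, this forces D(u) =
    0. *)
Lemma qgh_commutation_polynomial (f0 : {poly F}) (u v : A) : (2 < size f0)%N ->
  u != 0 -> v != 0 ->
  u * v = v * horner_alg u f0 -> exists p, u = horner_alg h p.
Proof.
have [D [DM D0 Dh Dc]] := qgh_degree presA nzq ncf.
move=> szf nzu nzv uv; apply: D0; apply/eqP; rewrite -leqn0 leqNgt; apply/negP=> Du.
(* For D(u) > 0 the degree of p(u) is deg(p) D(u): in Horner form, each added scalar leaves a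
   positive degree unchanged. *)
have Dpoly p : p != 0 ->
    horner_alg u p != 0 /\ D (horner_alg u p) = ((size p).-1 * D u)%N.
  elim/poly_ind: p => [|p c IHp]; first by rewrite eqxx.
  have D0' : D 0 = 0%N by rewrite -(rmorph0 (horner_alg h)) Dh.
  have [->|nzp] := eqVneq p 0.
    rewrite mul0r add0r polyC_eq0 => nzc; rewrite horner_algC size_polyC nzc mul0n.
    rewrite scaler_eq0 (negPf nzc) oner_eq0; split=> //.
    by rewrite -(horner_algC h) Dh.
  move=> _; have [nzpu Dpu] := IHp nzp; have [nz DE] := DM _ _ nzpu nzu.
  have Dpos : (0 < D (horner_alg u p * u)%R)%N by rewrite DE addn_gt0 Du orbT.
  rewrite rmorphD rmorphM /= horner_algX horner_algC Dc //; split.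
    by apply: contraTneq (Dpos) => eq0; rewrite -(Dc _ c) ?eq0 ?D0'.
  rewrite size_MXaddC (negPf nzp) /= DE Dpu -{2}[D u]mul1n -mulnDl addn1.
  by rewrite -polySpred.
have nzf : f0 != 0 by rewrite -size_poly_gt0 (ltn_trans _ szf).
have [nzfu Dfu] := Dpoly _ nzf.
have [_] := DM u v nzu nzv; rewrite uv; have [_ ->] := DM _ _ nzv nzfu.
move/eqP; rewrite Dfu addnC eqn_add2r -{2}[D u]mul1n eqn_pmul2r //.
by move: szf; case: (size f0) => [|[|[]]].
Qed.

Lemma intertwine_degree (p r : {poly F}) (P : T) :
  horner_alg h p * ev P = ev P * horner_alg h r -> forall i j, P`_i`_j != 0 ->
  ((size p).-1 * (size f).-1 ^ i = (size r).-1 * (size f).-1 ^ j)%N.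
Proof.
move=> /(eval_intertwine presA) com i j nzP.
have := congr1 (fun s : {poly F} => (size s).-1) (com i j nzP).
by rewrite !size_comp_poly !deg_fiter.
Qed.

(** Once u = p(h) with p nonconstant, a term x^i _ y^j of v forces (deg f)^i = deg(f0) (deg f)^j,
    which fails at i = 0 because deg f0 >= 2; for w the roles of i and j are exchanged. Keeping [f0]
    arbitrary allows use for both an isomorphism and its inverse. *)
Lemma qgh_rigidity (f0 : {poly F}) (u v w : A) : (2 < size f0)%N ->
  (forall c, u != c%:A) -> v != 0 -> w != 0 ->
  u * v = v * horner_alg u f0 -> w * u = horner_alg u f0 * w ->
  [/\ (2 < size f)%N, exists p, u = horner_alg h p,
      exists v', v = x * v' & exists w', w = w' * y].
Proof.
move=> szf nsu nzv nzw uv wu.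
have nzu : u != 0 by have := nsu 0; rewrite scale0r.
have [p up] := qgh_commutation_polynomial szf nzu nzv uv.
have szp : (1 < size p)%N.
  rewrite ltnNge; apply/negP => /size1_polyC pc.
  by have := nsu p`_0; rewrite up {1}pc horner_algC eqxx.
have [P vP] := pbw_eval_surj presA v; have [S wS] := pbw_eval_surj presA w.
have d0 : (1 < (size f0).-1)%N by move: szf; case: (size f0) => [|[|[]]].
have d1 : (0 < (size f).-1)%N by move: ncf; case: (size f) => [|[]].
have e_gt0 : (0 < (size p).-1)%N by move: szp; case: (size p) => [|[]].
have degP i j : P`_i`_j != 0 -> ((size f).-1 ^ i = (size f0).-1 * (size f).-1 ^ j)%N.
  move: uv; rewrite up vP horner_alg_comp => /intertwine_degree deg /deg /eqP.
  by rewrite size_comp_poly -mulnA mulnCA eqn_pmul2l // => /eqP.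
have degS i j : S`_i`_j != 0 -> ((size f).-1 ^ j = (size f0).-1 * (size f).-1 ^ i)%N.
  move: wu; rewrite up wS horner_alg_comp => /esym/intertwine_degree deg /deg /eqP.
  by rewrite size_comp_poly -mulnA mulnCA eqn_pmul2l // => /eqP.
have not1 j : (1 = (size f0).-1 * (size f).-1 ^ j)%N -> False.
  move=> e; have: (1 < (size f0).-1 * (size f).-1 ^ j)%N.
    by rewrite (leq_trans d0) // leq_pmulr // expn_gt0 d1.
  by rewrite -e.
have P0 : P`_0 = 0.
  by apply/polyP => j; rewrite coef0; apply/eqP/negPn/negP => /degP /not1.
have S0 i : S`_i`_0 = 0.
  by apply/eqP/negPn/negP => /degS /not1.
split.
- have nzP : P != 0 by apply: contraNneq nzv => P_0; rewrite vP P_0 raddf0.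
  (* At a nonzero coefficient of v, deg f = 1 would give deg f0 = 1. *)
  have := degP (size P).-1 (size P`_(size P).-1).-1.
  rewrite -!lead_coefE lead_coef_eq0 lead_coef_eq0 => /(_ nzP).
  have [eq1|ne1 _] := eqVneq (size f).-1 1%N.
    by rewrite eq1 !exp1n muln1 => eq; rewrite -eq in d0.
  by move: ncf ne1; case: (size f) => [|[|[]]].
- by exists p.
(* With the coefficient of x^0 zero, dropping it divides by x on the left; below, the same is done
   for y on the right. *)
- exists (ev (drop_poly 1 P)); rewrite -pbw_eval_xact vP; congr pbw_eval.
  by apply/polyP => -[|i]; rewrite coef_xact ?P0 // coef_drop_poly addn1.
- exists (\sum_(i < size S) x ^+ i * yeval y h (drop_poly 1 S`_i)).
  rewrite wS (@pbw_eval_widen _ _ _ _ _ (size S)) // mulr_suml.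
  apply: eq_bigr => i _; rewrite -mulrA -yevalMX; congr (_ * yeval _ _ _).
  by apply/polyP => -[|j]; rewrite coefMX ?S0 // coef_drop_poly addn1.
Qed.
End Rigidity.

(** * Affine conjugation and the classification *)

(** Normal form of a chain of transformations: one affine substitution p and one scalar k. Using p o
    f' = f o p avoids the inverse of p and makes transitivity immediate. *)
Definition affine_conj (F : fieldType) (f g f' g' : {poly F}) :=
  exists (p : {poly F}) (k : F), [/\ size p = 2%N, k != 0, p \Po f' = f \Po p & k *:
    g' = g \Po p].

Section AffineConj.
Variable F : fieldType.
Implicit Types f g p : {poly F}.

Lemma size2_polyE p : size p = 2%N -> p = p`_1 *: 'X + (p`_0)%:P.
Proof.
move=> sz; rewrite -[LHS]coefK sz poly_def !big_ord_recl big_ord0 /= expr0 expr1.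
by rewrite addr0 alg_polyC addrC.
Qed.

Lemma size2_poly_lead p : size p = 2%N -> p`_1 != 0.
Proof.
by move=> sz; have := lead_coef_eq0 p; rewrite lead_coefE sz -size_poly_eq0 sz /= => ->.
Qed.

Lemma size2_poly_inverse p : size p = 2%N ->
  exists r : {poly F}, [/\ size r = 2%N, r \Po p = 'X & p \Po r = 'X].
Proof.
move=> sz; have nza := size2_poly_lead sz; move: (size2_polyE sz) nza.
move: (p`_1) (p`_0) => a b -> nza; exists (a^-1 *: ('X - b%:P)).
rewrite size_scale ?invr_eq0 // size_XsubC !(comp_polyB, comp_polyD, comp_polyZ).
rewrite !comp_polyX !comp_polyC addrK !scalerA mulVf // mulfV // !scale1r.
by split => //; rewrite subrK.
Qed.

Lemma affine_conj_trans f g f1 g1 f2 g2 :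
  affine_conj f g f1 g1 -> affine_conj f1 g1 f2 g2 -> affine_conj f g f2 g2.
Proof.
move=> [p1 [k1 [sz1 nz1 pf1 pg1]]] [p2 [k2 [sz2 nz2 pf2 pg2]]].
exists (p1 \Po p2), (k1 * k2); split.
- by rewrite size_comp_poly2.
- by rewrite mulf_neq0.
- by rewrite -comp_polyA pf2 comp_polyA pf1 -comp_polyA.
- by rewrite -scalerA pg2 -comp_polyZ pg1 comp_polyA.
Qed.

Lemma affine_conj_step (u u' : {poly F} * {poly F}) : qgh_step u u' ->
  affine_conj u.1 u.2 u'.1 u'.2.
Proof.
case=> [a f g | l f g nzl | l m f g nzl nzm] /=.
- exists ('X - a%:P), 1; split; rewrite ?size_XsubC ?oner_neq0 ?scale1r //.
  by rewrite comp_polyB comp_polyX comp_polyC addrK.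
- exists (l^-1 *: 'X), 1; split; rewrite ?oner_neq0 ?scale1r //.
    by rewrite size_scale ?size_polyX // invr_eq0.
  by rewrite comp_polyZ comp_polyX scalerA mulVf // scale1r.
- exists 'X, (l * m)^-1; split; rewrite ?size_polyX ?invr_eq0 ?mulf_neq0 //.
    by rewrite comp_polyX comp_polyXr.
  by rewrite scalerA mulVf ?mulf_neq0 // scale1r comp_polyXr.
Qed.

Lemma qgh_reachP f g f' g' : qgh_reach (f, g) (f', g') <-> affine_conj f g f' g'.
Proof.
split.
  move=> r; rewrite -/((f, g).1) -/((f, g).2) -/((f', g').1) -/((f', g').2).
  elim: r => [u | u u1 u2 /affine_conj_step s _ IH]; last exact: affine_conj_trans s IH.
  exists 'X, 1; split; rewrite ?size_polyX ?oner_neq0 //.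
    by rewrite comp_polyX comp_polyXr.
  by rewrite scale1r comp_polyXr.
move=> [p [k [sz nzk]]]; have nza := size2_poly_lead sz.
move: (size2_polyE sz) nza; move: (p`_1) (p`_0) => a b -> nza fE gE.
(* For p = a h + b: type (I) with -b, type (II) with 1/a and type (III) with 1/k turn f into the
   conjugate of f by p, and g into (g o p)/k. *)
apply: qgh_reach_step (qgh_stepI (- b) f g) _.
have nza' : a^-1 != 0 by rewrite invr_eq0.
apply: qgh_reach_step (qgh_stepII _ _ nza') _.
have nzk' : k^-1 != 0 by rewrite invr_eq0.
apply: qgh_reach_step (qgh_stepIII _ _ nzk' (oner_neq0 _)) _.
have pE : ('X - (- b)%:P) \Po (a^-1^-1 *: 'X) = a *: 'X + b%:P.
  by rewrite comp_polyB comp_polyX comp_polyC invrK polyCN opprK.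
rewrite comp_polyD -!comp_polyA pE -fE -gE comp_polyC comp_polyD comp_polyZ
  comp_polyX comp_polyC.
rewrite polyCN addrK !scalerA mulVf // mulr1 mulVf // !scale1r.
exact: qgh_reach_refl.
Qed.
End AffineConj.

(** * Isomorphism and affine conjugacy *)

Section Iso.
Variables (F : fieldType) (q q' : F) (f g f' g' : {poly F}).
Variables (A A' : algType F) (x y h : A) (x' y' h' : A').
Hypothesis presA : is_qgh_presentation q f g x y h.
Hypothesis presA' : is_qgh_presentation q' f' g' x' y' h'.

Lemma lrmorph_inverse (phi : {lrmorphism A -> A'}) : bijective phi ->
  exists psi : {lrmorphism A' -> A}, cancel phi psi /\ cancel psi phi.
Proof.
case=> psi phiK psiK.
pose m1 := GRing.isZmodMorphism.Build _ _ psi (can2_zmod_morphism phiK psiK).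
pose m2 := GRing.isMonoidMorphism.Build _ _ psi (can2_monoid_morphism phiK psiK).
pose m3 := GRing.isScalable.Build _ _ _ _ psi (can2_scalable phiK psiK).
pose psi' : {lrmorphism A' -> A} := HB.pack psi m1 m2 m3.
by exists psi'.
Qed.

Lemma iso_affine_conj : q != 0 -> (2 < size f)%N -> alg_iso A A' ->
  q = q' /\ affine_conj f g f' g'.
Proof.
move=> nzq szf [phi /lrmorph_inverse[psi [phiK psiK]]].
have ncf : (1 < size f)%N by apply: ltn_trans szf.
have phi_neq0 (a : A) : a != 0 -> phi a != 0.
  by apply: contra_neq => a0; rewrite -[a]phiK a0 rmorph0.
have psi_neq0 (a : A') : a != 0 -> psi a != 0.
  by apply: contra_neq => a0; rewrite -[a]psiK a0 rmorph0.
(* The absence of zero divisors transfers along the isomorphism and supplies the hypotheses on q'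
   and f' that rigidity needs in A'. *)
have noZD : ~ (q' = 0 \/ (size f' <= 1)%N).
  move=> /(qgh_zero_divisor presA')[a [b [nza nzb ab0]]].
  have /eqP[] := qgh_domain presA nzq ncf (psi_neq0 _ nza) (psi_neq0 _ nzb).
  by rewrite -rmorphM ab0 rmorph0.
have nzq' : q' != 0 by apply/eqP => q0; apply: noZD; left.
have ncf' : (1 < size f')%N by rewrite ltnNge; apply/negP => le1; apply: noZD; right.
have [X1 Y1 R1] := qgh_rel_lrmorph phi (proj1 presA).
have [X2 Y2 _] := qgh_rel_lrmorph psi (proj1 presA').
have nsphi c : phi h != c%:A.
  apply: contraNneq (gen_h_nonscalar presA c) => hc.
  by rewrite -[h]phiK hc rmorph_alg.
have nspsi c : psi h' != c%:A.
  apply: contraNneq (gen_h_nonscalar presA' c) => hc.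
  by rewrite -[h']psiK hc rmorph_alg.
(* Rigidity in A' also yields deg f' >= 2, which the application to the inverse requires. *)
have [szf' [p hp] [v1 xv1] [w1 yw1]] := qgh_rigidity presA' nzq' ncf' szf nsphi
  (phi_neq0 _ (gen_x_neq0 presA)) (phi_neq0 _ (gen_y_neq0 presA)) X1 Y1.
have [_ [r hr] [v2 xv2] [w2 yw2]] := qgh_rigidity presA nzq ncf szf' nspsi
  (psi_neq0 _ (gen_x_neq0 presA')) (psi_neq0 _ (gen_y_neq0 presA')) X2 Y2.
(* From h' = phi(psi(h')) = r(p(h')); degrees multiply under composition, so p has degree 1. *)
have rp : r \Po p = 'X.
  apply: (horner_alg_inj presA'); rewrite -horner_alg_comp -hp -lrmorph_horner_alg.
  by rewrite -hr psiK horner_algX.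
have szp : size p = 2%N.
  have /eqP := congr1 (fun s : {poly F} => (size s).-1) rp.
  rewrite size_comp_poly size_polyX muln_eq1 => /andP[_].
  by case: (size p) => [|[|[]]].
have cancelx (a b : A') : x' * a = x' * b -> a = b.
  move/eqP; rewrite -subr_eq0 -mulrBr => eq0; apply/eqP; rewrite -subr_eq0.
  by apply: contraTT eq0 => nz;
    have := qgh_domain presA' nzq' ncf' (gen_x_neq0 presA') nz; exact.
have cancely (a b : A') : a * y' = b * y' -> a = b.
  move/eqP; rewrite -subr_eq0 -mulrBl => eq0; apply/eqP; rewrite -subr_eq0.
  by apply: contraTT eq0 => nz;
    have := qgh_domain presA' nzq' ncf' nz (gen_y_neq0 presA'); exact.
(* Substituting one factorization into the other gives x' = x' v1 phi(v2), so v1 has a right inverse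
   and is a scalar; y is treated likewise on the other side. *)
have [c nzc v1c] : exists2 c, c != 0 & v1 = c%:A.
  apply: (qgh_mul1_scalar presA' nzq' ncf' (b := phi v2)); apply: cancelx.
  by rewrite mulrA -xv1 -rmorphM -xv2 /= psiK mulr1.
have [d nzd w2d] : exists2 d, d != 0 & phi w2 = d%:A.
  apply: (qgh_mul1_scalar presA' nzq' ncf' (b := w1)); apply: cancely.
  by rewrite -mulrA -yw1 -rmorphM -yw2 /= psiK mul1r.
have phix : phi x = c *: x' by rewrite xv1 v1c -scalerAr mulr1.
have phiy : phi y = d^-1 *: y'.
  have -> : y' = d *: phi y.
    by rewrite -[LHS]psiK yw2 rmorphM /= w2d -scalerAl mul1r.
  by rewrite scalerA mulVf // scale1r.
(* The scalar with phi(y) phi(x) = k y' x'. *)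
pose k := d^-1 * c; have nzk : k != 0 by rewrite mulf_neq0 ?invr_eq0.
have pf : p \Po f' = f \Po p.
  move: X1; rewrite phix hp -scalerAr -scalerAl => /(scalerI nzc).
  rewrite (horner_mulx (proj1 presA')) horner_alg_comp.
  by move/cancelx/(horner_alg_inj presA').
(* The image of the third relation of A minus k times that of A': the y' x' terms cancel. *)
have key : (k * (q' - q)) *: (x' * y') = horner_alg h' ((g \Po p) - k *: g').
  have [_ _ yx'] := proj1 presA'.
  move: R1; rewrite phix phiy hp horner_alg_comp => R1.
  rewrite -(mul_polyC k) rmorphB rmorphM /= horner_algC mulr_algl -R1 -yx'.
  rewrite -!scalerAl -!scalerAr !scalerA scalerBr !scalerA.
  have -> : q * c / d = k * q by rewrite mulrC [q * c]mulrC mulrA.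
  by rewrite -/k opprB [RHS]addrC addrA subrK -scalerBl -mulrBr.
(* In coordinates one side is a multiple of x' y' and the other a polynomial in h', so both vanish;
   this gives q = q' and k g' = g o p. *)
have {key} keyP : ((k * (q' - q))%:P *: 'X : {poly {poly F}})%:P * 'X
   = ((g \Po p) - k *: g')%:P%:P.
  apply: (pbw_eval_inj presA'); rewrite pbw_evalC yevalC -key.
  rewrite [LHS]pbw_eval_xact pbw_evalC yevalZ horner_algC.
  rewrite -(pbw_evalC x') -(gen_y_eval x' y' h').
  by rewrite -scalerAl mul1r scalerAr.
have qq : q = q'.
  have := congr1 (fun s : {poly {poly {poly F}}} => s`_1`_1) keyP.
  rewrite coefMX !coefC coefZ coefX mulr1 => /eqP.
  by rewrite polyC_eq0 mulf_eq0 (negPf nzk) subr_eq0 => /eqP ->.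
split=> //; exists p, k; split=> //.
apply/esym/eqP; rewrite -subr_eq0.
have /esym/eqP : 0 = ((g \Po p) - k *: g')%:P :> {poly {poly F}}.
  have := congr1 (fun s : {poly {poly {poly F}}} => s`_0) keyP.
  by rewrite coefMX [X in _ = X]coefC; exact.
by rewrite polyC_eq0.
Qed.
End Iso.

(** Shows that x, y, h may be sent to x', k y', p(h'). The scalar is put on y alone because only the
    product of the scalars on x and y enters the relations. *)
Lemma affine_conj_rel (F : fieldType) (q : F) (f g f' g' p : {poly F}) (k : F)
    (B : algType F) (x y h : B) :
  p \Po f' = f \Po p -> k *: g' = g \Po p ->
  qgh_rel q f' g' x y h -> qgh_rel q f g x (k *: y) (horner_alg h p).
Proof.
move=> pf pg rel; have [_ _ yx] := rel; split.
- by rewrite horner_alg_comp (horner_mulx rel) pf.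
- by rewrite horner_alg_comp -scalerAl (y_mul_horner rel) pf scalerAr.
- rewrite horner_alg_comp -pg -mul_polyC rmorphM /= horner_algC mulr_algl -yx.
  by rewrite -scalerAl -scalerAr scalerBr !scalerA mulrC.
Qed.

(** The inverse morphism comes from the inverse substitution r and 1/k; both composites fix the
    generators, hence are identities by uniqueness. *)
Lemma affine_conj_iso (F : fieldType) (q : F) (f g f' g' : {poly F})
  (A A' : algType F) (x y h : A) (x' y' h' : A') :
  is_qgh_presentation q f g x y h -> is_qgh_presentation q f' g' x' y' h' ->
  affine_conj f g f' g' -> alg_iso A A'.
Proof.
move=> presA presA' [p [k [sz nzk pf pg]]].
have [r [_ rp pr]] := size2_poly_inverse sz.
have rf : r \Po f = f' \Po r.
  by rewrite -[f in LHS]comp_polyXr -pr [f \Po _]comp_polyA -pf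
     -[_ \Po f' \Po r]comp_polyA [r \Po _]comp_polyA rp comp_polyX.
have rg : k^-1 *: g = g' \Po r.
  have -> : g = k *: (g' \Po r) by rewrite -comp_polyZ pg -comp_polyA pr comp_polyXr.
  by rewrite scalerA mulVf // scale1r.
have [[theta [tx ty th]] _] := (proj2 presA) _ _ _ _ (affine_conj_rel pf pg (proj1
  presA')).
have [[eta [ex ey eh]] _] := (proj2 presA') _ _ _ _ (affine_conj_rel rf rg (proj1
  presA)).
exists theta; exists eta => a.
  have [_ uniq] := (proj2 presA) _ _ _ _ (proj1 presA).
  apply: (uniq (eta \o theta) idfun); rewrite /= ?tx ?ty ?th //.
    by rewrite linearZ /= ey scalerA mulfV // scale1r.
  by rewrite lrmorph_horner_alg eh horner_alg_comp pr horner_algX.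
have [_ uniq] := (proj2 presA') _ _ _ _ (proj1 presA').
apply: (uniq (theta \o eta) idfun); rewrite /= ?ex ?ey ?eh //.
  by rewrite linearZ /= ty scalerA mulVf // scale1r.
by rewrite lrmorph_horner_alg th horner_alg_comp rp horner_algX.
Qed.

Theorem theorem4p2 (F : fieldType) (q q' : F) (f g f' g' : {poly F})
  (A A' : algType F) (x y h : A) (x' y' h' : A') :
  is_qgh_presentation q f g x y h ->
  is_qgh_presentation q' f' g' x' y' h' ->
  q != 0 -> (2 < size f)%N ->
  (alg_iso A A' <-> q = q' /\ qgh_reach (f, g) (f', g')) /\
  (alg_iso A A' -> size f = size f' /\ size g = size g').
Proof.
move=> presA presA' nzq szf; have fwd := iso_affine_conj presA presA' nzq szf.
split; first split.
- by case/fwd=> -> /qgh_reachP.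
- by case=> qq /qgh_reachP; move: presA'; rewrite -qq => presA';
  apply: affine_conj_iso presA presA'.
case/fwd=> _ [p [k [sz nzk pf pg]]]; split; last first.
  by rewrite -(size_comp_poly2 g sz) -pg size_scale.
(* Degrees give equality of the predecessors of the sizes; since size f > 2, truncation at size 0
   causes no ambiguity. *)
have := congr1 (fun s : {poly F} => (size s).-1) pf.
rewrite size_comp_poly size_comp_poly sz mul1n muln1.
by move: szf; case: (size f) (size f') => [|[|[|n]]] [|[|m]] //= _ ->.
Qed.
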